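(* Let $R$ be an order in a number field. Then $R$ is an associated order if and only if $R$ is both an ideal-preserving order and a locally associated order.
   Context: An order $R$ in a number field $K$ is a subring (with identity) of the ring of integers $\mathcal{O}_K$ of finite index; its integral closure is $\overline{R}=\mathcal{O}_K$. $U(A)$ denotes the group of units of a commutative ring $A$. The conductor ideal of $R$ is $I=(R:\overline{R})=\{\alpha\in\overline{R} : \alpha\overline{R}\subseteq R\}$. - $R$ is an associated order if $\overline{R}=R\cdot U(\overline{R})$, i.e. for every $t\in \overline{R}$ there exist $r\in R$ and $u\in U(\overline{R})$ with $t=ru$. - $R$ is an ideal-preserving order if for any ideals $J_1,J_2$ of $\overline{R}$ with $J_1\nsubseteq J_2$, one has $R\cap J_1\nsubseteq J_2$. - $R$ is a locally associated order if $U(\overline{R})/U(R)\cong U(\overline{R}/I)/U(R/I)$ as groups. *)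

(* Defs.v *)
From HB Require Import structures.
From mathcomp Require Import boolp classical_sets cardinality.
From mathcomp Require Export all_boot all_order all_algebra all_field.

Set Implicit Arguments.
Unset Strict Implicit.
Unset Printing Implicit Defensive.

Import GRing.Theory.

Local Open Scope ring_scope.
Local Open Scope quotient_scope.

(* A unit is stored with its inverse, as a pair (x, y) such that x * y = 1;
   since the inverse is unique, this is the set of invertible elements of B.
   B may be the zero ring, hence the group is not built from unitRingType. *)
Section Units.
Variable B : comPzRingType.

Record units := Units {
  units_pair : B * B;
  _ : units_pair.1 * units_pair.2 == 1 }.

HB.instance Definition _ := [isSub for units_pair].
HB.instance Definition _ := [Choice of units by <:].

Definition uval (u : units) : B := (val u).1.
Definition uinv (u : units) : B := (val u).2.

Lemma uvalV u : uval u * uinv u = 1.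
Proof. exact/eqP/(valP u). Qed.

Lemma uval_inj : injective uval.
Proof.
move=> u v uv; apply: val_inj; rewrite [val u]surjective_pairing.
rewrite [val v]surjective_pairing -/(uval _) -/(uval _) -/(uinv _) -/(uinv _).
congr (_, _) => //.
rewrite -[LHS]mulr1 -(uvalV v) -uv mulrA (mulrC (uinv u)) uvalV.
exact: mul1r.
Qed.

Fact units_one_subproof : (1 : B) * 1 == 1.
Proof. by rewrite mulr1. Qed.
Definition units_one : units := @Units (1, 1) units_one_subproof.

Fact units_inv_subproof u : uinv u * uval u == 1.
Proof. by rewrite mulrC uvalV. Qed.
Definition units_inv u : units :=
  @Units (uinv u, uval u) (units_inv_subproof u).

Fact units_mul_subproof u v :
  (uval u * uval v) * (uinv u * uinv v) == 1.
Proof. by rewrite mulrACA !uvalV mulr1. Qed.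
Definition units_mul u v : units :=
  @Units (uval u * uval v, uinv u * uinv v) (units_mul_subproof u v).

Fact units_mulA : associative units_mul.
Proof. by move=> u v w; apply: uval_inj; apply: mulrA. Qed.
Fact units_mulC : commutative units_mul.
Proof. by move=> u v; apply: uval_inj; apply: mulrC. Qed.
Fact units_mul1 : left_id units_one units_mul.
Proof. by move=> u; apply: uval_inj; apply: mul1r. Qed.
Fact units_mulV : left_inverse units_one units_inv units_mul.
Proof. by move=> u; apply: uval_inj; rewrite /uval /= mulrC uvalV. Qed.
Fact units_mulr1 : right_id units_one units_mul.
Proof. by move=> u; rewrite units_mulC units_mul1. Qed.
Fact units_mulrV : right_inverse units_one units_inv units_mul.
Proof. by move=> u; rewrite units_mulC units_mulV. Qed.

HB.instance Definition _ := isGroup.Build units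
  units_mulA units_mul1 units_mulr1 units_mulV units_mulrV.

End Units.

Section UnitQuotient.
Variables (B : comPzRingType) (S : subringClosed B).
Local Open Scope group_scope.

(* U(S), as a subgroup of U(B): the units of B in S whose inverse is in S. *)
Definition subunits : {pred units B} :=
  [pred u | (uval u \in S) && (uval u^-1 \in S)].

Fact subunits1 : 1 \in subunits.
Proof. by rewrite inE /= !rpred1. Qed.
Fact subunitsM : mulg_closed subunits.
Proof.
by move=> u v /andP[u1 u2] /andP[v1 v2]; rewrite inE /= !rpredM.
Qed.
Fact subunitsV : invg_closed subunits.
Proof. by move=> u /andP[u1 u2]; rewrite inE /= invgK u1 u2. Qed.

HB.instance Definition _ := isMulClosed.Build (units B) subunits subunitsM.
HB.instance Definition _ := isInvClosed.Build (units B) subunits subunitsV.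
HB.instance Definition _ := isMul1Closed.Build (units B) subunits subunits1.

(* unit_quot is the group U(B) / U(S); coset product is well defined as B is
   commutative. *)
Definition unit_equiv (u v : units B) := u / v \in subunits.

Lemma unit_equiv_is_equiv : equiv_class_of unit_equiv.
Proof.
split=> [u|u v|v u w]; rewrite /unit_equiv.
- by rewrite divgg; exact: subunits1.
- exact: (gpredFC subunits).
- move=> uv vw; rewrite -[u](divgK v) -mulgA.
  exact: subunitsM.
Qed.

Canonical unit_equiv_rel := EquivRelPack unit_equiv_is_equiv.
Canonical unit_equiv_enc := defaultEncModRel unit_equiv.

Definition unit_quot := {eq_quot unit_equiv}.

HB.instance Definition _ : EqQuotient (units B) unit_equiv unit_quot :=
  EqQuotient.on unit_quot.
HB.instance Definition _ := Choice.on unit_quot.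

Definition unit_quot_one : unit_quot := \pi_unit_quot 1.
Definition unit_quot_inv (x : unit_quot) : unit_quot :=
  \pi_unit_quot ((repr x)^-1).
Definition unit_quot_mul (x y : unit_quot) : unit_quot :=
  \pi_unit_quot (repr x * repr y).

Lemma unit_quot_eqP (u v : units B) :
  reflect (\pi_unit_quot u = \pi_unit_quot v) (u / v \in subunits).
Proof. by apply: (iffP idP) => [uv|/eqmodP //]; apply/eqmodP. Qed.

Lemma unit_quot_pi_inv (u : units B) :
  unit_quot_inv (\pi_unit_quot u) = \pi_unit_quot u^-1.
Proof.
apply/unit_quot_eqP; rewrite invgK (units_mulC _ u : _ * u = u * _).
by apply/unit_quot_eqP; rewrite reprK.
Qed.

Lemma unit_quot_pi_mul (u v : units B) :
  unit_quot_mul (\pi_unit_quot u) (\pi_unit_quot v) = \pi_unit_quot (u * v).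
Proof.
apply/unit_quot_eqP; set u' := repr _; set v' := repr _.
have Eu : u' / u \in subunits by apply/unit_quot_eqP; rewrite reprK.
have Ev : v' / v \in subunits by apply/unit_quot_eqP; rewrite reprK.
have -> : u' * v' / (u * v) = (u' / u) * (v' / v).
  by apply: uval_inj; exact: mulrACA.
exact: subunitsM.
Qed.

Fact unit_quot_mulA : associative unit_quot_mul.
Proof.
elim/quotW=> x; elim/quotW=> y; elim/quotW=> z.
rewrite (unit_quot_pi_mul y z) (unit_quot_pi_mul x y).
by rewrite (unit_quot_pi_mul x) (unit_quot_pi_mul _ z) mulgA.
Qed.
Fact unit_quot_mulC : commutative unit_quot_mul.
Proof.
move=> x y; rewrite /unit_quot_mul.
by rewrite (units_mulC _ _ : repr x * repr y = repr y * repr x).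
Qed.
Fact unit_quot_mul1 : left_id unit_quot_one unit_quot_mul.
Proof. by move=> x; rewrite -[x]reprK unit_quot_pi_mul mul1g. Qed.
Fact unit_quot_mulV : left_inverse unit_quot_one unit_quot_inv unit_quot_mul.
Proof.
by move=> x; rewrite -[x]reprK unit_quot_pi_inv unit_quot_pi_mul mulVg.
Qed.
Fact unit_quot_mulr1 : right_id unit_quot_one unit_quot_mul.
Proof. by move=> x; rewrite unit_quot_mulC unit_quot_mul1. Qed.
Fact unit_quot_mulrV : right_inverse unit_quot_one unit_quot_inv unit_quot_mul.
Proof. by move=> x; rewrite unit_quot_mulC unit_quot_mulV. Qed.

HB.instance Definition _ := isGroup.Build unit_quot
  unit_quot_mulA unit_quot_mul1 unit_quot_mulr1 unit_quot_mulV unit_quot_mulrV.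

End UnitQuotient.

Arguments subunits {B} S.

(* Between groups, a multiplicative map preserves 1 and inverses. *)
Definition isomorphic (G H : groupType) : Prop :=
  exists f : {multiplicative G -> H}, bijective f.

Section Extension.
Variables (A : comPzRingType) (R : subringClosed A).

Definition finite_index : Prop := finite_set [set: Quotient.quot R].

(* Unlike the library's idealr, an ideal may be the whole ring. *)
Definition is_ideal (J : {pred A}) : Prop :=
  zmod_closed J /\ {in J, forall x a, a * x \in J}.

Definition associated : Prop :=
  forall t : A, exists r (u : units A), r \in R /\ t = r * uval u.

Definition ideal_preserving : Prop :=
  forall J1 J2 : {pred A}, is_ideal J1 -> is_ideal J2 ->
  ~ {subset J1 <= J2} -> ~ {subset [predI R & J1] <= J2}.

Definition conductor : {pred A} :=
  [pred a : A | `[< forall b : A, a * b \in R >]].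

Lemma conductorP a : reflect (forall b, a * b \in R) (a \in conductor).
Proof. exact: asboolP. Qed.

Lemma conductor_ideal : is_ideal conductor.
Proof.
split; first split.
- by apply/conductorP => b; rewrite mul0r rpred0.
- move=> x y /conductorP Ix /conductorP Iy; apply/conductorP => b.
  by rewrite mulrBl rpredB.
- move=> x /conductorP Ix a; apply/conductorP => b.
  by rewrite -mulrA mulrCA Ix.
Qed.

HB.instance Definition _ :=
  GRing.isZmodClosed.Build A conductor conductor_ideal.1.

(* The ring A / I.  The library's ring structure on Quotient.quot requires a
   proper ideal, whereas A / I is the zero ring when R = A. *)
Definition conductor_quot : Type := Quotient.quot conductor.

HB.instance Definition _ := GRing.Zmodule.on conductor_quot.
HB.instance Definition _ :=
  EqQuotient.copy conductor_quot (Quotient.quot conductor).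

Definition conductor_quot_one : conductor_quot := \pi_conductor_quot 1.
Definition conductor_quot_mul (x y : conductor_quot) : conductor_quot :=
  \pi_conductor_quot (repr x * repr y).

Lemma conductor_quot_eqP (a b : A) :
  reflect (\pi_conductor_quot a = \pi_conductor_quot b) (a - b \in conductor).
Proof. by rewrite Quotient.idealrBE; apply: eqP. Qed.

Lemma conductor_quot_pi_mul (a b : A) :
  conductor_quot_mul (\pi_conductor_quot a) (\pi_conductor_quot b)
  = \pi_conductor_quot (a * b).
Proof.
apply/conductor_quot_eqP; set a' := repr _; set b' := repr _.
have Ia : a' - a \in conductor by apply/conductor_quot_eqP; rewrite reprK.
have Ib : b' - b \in conductor by apply/conductor_quot_eqP; rewrite reprK.
have -> : a' * b' - a * b = b' * (a' - a) + a * (b' - b).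
  by rewrite !mulrBr (mulrC b' a') (mulrC b' a) addrA subrK.
by rewrite rpredD //; apply: conductor_ideal.2.
Qed.

Lemma conductor_quot_pi_add (a b : A) :
  \pi_conductor_quot (a + b) = \pi_conductor_quot a + \pi_conductor_quot b.
Proof. exact: Quotient.pi_add. Qed.

Fact conductor_quot_mulA : associative conductor_quot_mul.
Proof.
elim/quotW=> x; elim/quotW=> y; elim/quotW=> z.
rewrite (conductor_quot_pi_mul y z) (conductor_quot_pi_mul x y).
by rewrite (conductor_quot_pi_mul x) (conductor_quot_pi_mul _ z) mulrA.
Qed.
Fact conductor_quot_mulC : commutative conductor_quot_mul.
Proof. by move=> x y; rewrite /conductor_quot_mul mulrC. Qed.
Fact conductor_quot_mul1 : left_id conductor_quot_one conductor_quot_mul.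
Proof. by move=> x; rewrite -[x]reprK conductor_quot_pi_mul mul1r. Qed.
Fact conductor_quot_mulD : left_distributive conductor_quot_mul +%R.
Proof.
elim/quotW=> x; elim/quotW=> y; elim/quotW=> z.
rewrite (conductor_quot_pi_mul x z) (conductor_quot_pi_mul y z).
by rewrite -!conductor_quot_pi_add (conductor_quot_pi_mul _ z) mulrDl.
Qed.

HB.instance Definition _ := GRing.Zmodule_isComPzRing.Build conductor_quot
  conductor_quot_mulA conductor_quot_mulC conductor_quot_mul1
  conductor_quot_mulD.

(* As I is contained in R, the ring R / I is the image of R in A / I. *)
Definition order_mod : {pred conductor_quot} :=
  [pred x | `[< exists2 r, r \in R & x = \pi r >]].

Lemma order_modP x :
  reflect (exists2 r, r \in R & x = \pi r) (x \in order_mod).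
Proof. exact: asboolP. Qed.

Fact order_mod_subring : subring_closed order_mod.
Proof.
split.
- by apply/order_modP; exists 1; rewrite ?rpred1.
- move=> _ _ /order_modP[r Rr ->] /order_modP[s Rs ->].
  apply/order_modP; exists (r - s); first exact: rpredB.
  by rewrite conductor_quot_pi_add; congr (_ + _); exact/esym/Quotient.pi_opp.
- move=> _ _ /order_modP[r Rr ->] /order_modP[s Rs ->].
  apply/order_modP; exists (r * s); first exact: rpredM.
  exact: conductor_quot_pi_mul.
Qed.

HB.instance Definition _ :=
  GRing.isSubringClosed.Build conductor_quot order_mod order_mod_subring.

Definition locally_associated : Prop :=
  isomorphic (unit_quot R) (unit_quot order_mod).

End Extension.

Arguments conductor {A} R.
Arguments order_mod {A} R.

Section RingOfIntegers.
Variable K : fieldExtType rat.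

Definition algebraic_integer : {pred K} :=
  [pred x | `[< integralOver (intr : int -> K) x >]].

Fact algebraic_integer_subring : subring_closed algebraic_integer.
Proof.
split=> [|x y /asboolP xZ /asboolP yZ|x y /asboolP xZ /asboolP yZ];
  apply/asboolP.
- exact: integral1.
- exact: integral_sub.
- exact: integral_mul.
Qed.

HB.instance Definition _ :=
  GRing.isSubringClosed.Build K algebraic_integer algebraic_integer_subring.

Record ring_of_integers := RingOfIntegers {
  ring_of_integers_val : K;
  _ : ring_of_integers_val \in algebraic_integer }.

HB.instance Definition _ := [isSub for ring_of_integers_val].
HB.instance Definition _ := [Choice of ring_of_integers by <:].
HB.instance Definition _ := [SubChoice_isSubComNzRing of ring_of_integers by <:].

End RingOfIntegers.

(* Main.v *)
(* Write A for the ring of integers and I for the conductor.  A/I is finite: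
   a is determined modulo I by the classes modulo R of a and of the products
   c a, for c in a set of representatives of A/R.  The canonical morphism
   U(A)/U(R) -> U(A/I)/U(R/I) is injective with finite target, so any abstract
   isomorphism between the two groups forces it to be onto.
   For the converse implication, fix t <> 0 and let V be the additive group of
   the v in A with
   t v in R.  If V contains a unit v modulo I, surjectivity gives v = r u
   modulo I with u in U(A) and r in U(R/I), whence t u in R.  To find v, no
   prime ideal is needed: a non-unit v in V has an idempotent power e <> 1
   modulo I, and the ideal-preserving property, applied to t J1 and t J2 with
   J1 the annihilator of e and J2 the nilradical modulo I, gives a w in V with
   e w = 0 and w not nilpotent.  The idempotent power of v + w is then strictly
   larger than e. *)
From HB Require Import structures.
From mathcomp Require Import boolp classical_sets cardinality.
Require Import Defs.
Set Implicit Arguments.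
Unset Strict Implicit.
Unset Printing Implicit Defensive.
Import GRing.Theory.
Local Open Scope ring_scope.
Local Open Scope quotient_scope.
Local Open Scope classical_set_scope.

(** * Finite sets and counting *)

Lemma finite_set_injective (T U : Type) (f : T -> U) :
  injective f -> finite_set [set: U] -> finite_set [set: T].
Proof.
move=> f_inj finU; rewrite -(preimage_setT f); apply: finite_preimage finU.
by move=> x y _ _; apply: f_inj.
Qed.

Lemma finite_set_seq (T : eqType) :
  finite_set [set: T] -> exists s : seq T, forall x, x \in s.
Proof.
by move=> /finite_seqP[s /seteqP[sT _]]; exists s => x; apply: sT.
Qed.

Lemma count_lt (T : eqType) (a b : pred T) (s : seq T) x :
  x \in s -> subpred a b -> ~~ a x -> b x -> (count a s < count b s)%N.
Proof.
move=> /splitPr[s1 s2] ab /negbTE ax bx.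
by rewrite !count_cat /= ax bx add0n add1n addnS ltnS leq_add ?sub_count.
Qed.

Lemma finite_injective_surj (T : eqType) (h : T -> T) :
  finite_set [set: T] -> injective h -> forall y, exists x, h x = y.
Proof.
move=> /finite_set_seq[s s_full] h_inj y.
have mem_s x : x \in undup s by rewrite mem_undup.
have h_uniq : uniq [seq h x | x <- undup s].
  by rewrite map_inj_uniq ?undup_uniq.
have [//||_ Eh] := uniq_min_size h_uniq (s2 := undup s).
  by rewrite size_map.
by have := mem_s y; rewrite -Eh => /mapP[x _ ->]; exists x.
Qed.

(** * Finite commutative rings: nilpotents, idempotents and units *)

Section FiniteRing.
Variable B : comPzRingType.

Lemma nilpotentB (x y : B) k l :
  x ^+ k = 0 -> y ^+ l = 0 -> (x - y) ^+ (k + l) = 0.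
Proof.
move=> xk yl; rewrite exprBn big1 // => i _.
have [li|il] := leqP l i.
  by rewrite -(subnK li) [y ^+ _]exprD yl !mulr0 mul0rn.
have -> : (k + l - i = k + (l - i))%N by rewrite addnBA // ltnW.
by rewrite exprD xk mul0r mulr0 mul0r mul0rn.
Qed.

Hypothesis finB : finite_set [set: B].

(** Among the first [(size s).+1] powers of x two agree, so the powers become periodic. The
    factorial is at least every pre-period and a multiple of every period, so one N serves all x. *)
Lemma idempotent_exponent :
  exists2 N, (0 < N)%N & forall x : B, x ^+ N * x ^+ N = x ^+ N.
Proof.
have [s mem_s] := finite_set_seq finB.
exists (size s).+1`!; first exact: fact_gt0.
move=> x; pose t := [seq x ^+ i | i <- iota 0 (size s).+1].
have /(uniqPn 0)[i [j [ij]]] : ~~ uniq t.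
  apply/negP => /uniq_leq_size /(_ (fun y _ => mem_s y)).
  by rewrite size_map size_iota ltnn.
rewrite size_map size_iota => js.
rewrite !(nth_map 0%N) ?size_iota ?(ltn_trans ij) //.
rewrite !nth_iota ?(ltn_trans ij) // !add0n => xij.
set N := _`!.
have iN : (i <= N)%N.
  exact: leq_trans (ltnW (ltn_trans ij js)) (fact_geq _).
have /dvdnP[k Nk] : (j - i %| N)%N.
  by apply: dvdn_fact; rewrite subn_gt0 ij (leq_trans (leq_subr _ _)) 1?ltnW.
have period m : x ^+ (i + m * (j - i)) = x ^+ i.
  elim: m => [|m IHm]; first by rewrite addn0.
  by rewrite mulSn addnA subnKC 1?ltnW // exprD -xij -exprD.
rewrite -exprD -{1}(subnK iN) -addnA {2}Nk exprD period -exprD.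
by rewrite subnK.
Qed.

Lemma unit_of_idempotents (V : {pred B}) : addr_closed V ->
  (forall e, e * e = e -> e != 1 ->
    exists2 w, w \in V & e * w = 0 /\ forall k, w ^+ k != 0) ->
  exists2 v, v \in V & exists v', v * v' = 1.
Proof.
move=> [V0 VD] V_w; have [N N_gt0 idN] := idempotent_exponent.
have [s mem_s] := finite_set_seq finB.
(* The complement of the ideal generated by the idempotent power of v. *)
pose moved v := [pred b : B | v ^+ N * b != b].
suff grow n : forall v, v \in V -> (count (moved v) s < n)%N ->
    exists2 v, v \in V & v ^+ N = 1.
  have [v Vv vN] := grow _ 0 V0 (ltnSn _).
  by exists v => //; exists (v ^+ N.-1); rewrite -exprS prednK.
elim: n => // n IHn v Vv vn.
have [vN|vN] := eqVneq (v ^+ N) 1; first by exists v.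
have [w Vw [ew w_nil]] := V_w _ (idN v) vN.
set e := v ^+ N in vN ew.
pose z := v + w; pose g := z ^+ N.
have ee : e * e = e by apply: idN.
have gg : g * g = g by apply: idN.
have eN : e ^+ N = e.
  by case: (N) N_gt0 => // k _; elim: k => // k IHk; rewrite exprS IHk ee.
have eg : e * g = e.
  by rewrite -{1}eN -exprMn mulrDr ew addr0 exprMn eN ee.
have [||v' Vv' v'N] := IHn z; [exact: VD| |by exists v'].
rewrite ltnS in vn; apply: leq_trans vn; apply: (count_lt (mem_s g)).
- move=> b /=; apply: contra => /eqP eb.
  by rewrite -eb mulrA (mulrC _ e) eg.
- by rewrite /= gg eqxx.
(* The count drops strictly at g unless e = g. In that case (1 - e) z and (1 - e) v both have N-th
   power (1 - e)^N e = 0, and their difference w would be nilpotent. *)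
rewrite /= eg; apply/eqP => e_g.
have fe : (1 - e) ^+ N * e = 0.
  rewrite -{2}eN -exprMn mulrBl mul1r ee subrr expr0n.
  by rewrite gtn_eqF.
have wE : w = (1 - e) * z - (1 - e) * v.
  by rewrite -mulrBr addrAC subrr add0r mulrBl mul1r ew subr0.
have := w_nil (N + N)%N; rewrite {1}wE nilpotentB ?eqxx // exprMn.
  by rewrite -/g -e_g.
exact: fe.
Qed.

(** The idempotent power of a unit is 1, so its inverse is one of its powers. *)
Lemma subring_inv (S : subringClosed B) (x y : B) :
  x \in S -> x * y = 1 -> y \in S.
Proof.
move=> Sx xy; have [N N_gt0 /(_ x) xN] := idempotent_exponent.
suff -> : y = x ^+ N.-1 by apply: rpredX.
have {}xN : x ^+ N = 1.
  have yN : x ^+ N * y ^+ N = 1 by rewrite -exprMn xy expr1n.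
  by rewrite -[LHS]mulr1 -yN mulrA xN.
by rewrite -[RHS]mulr1 -xy mulrA -exprSr prednK // xN mul1r.
Qed.

End FiniteRing.

(** * Reduction modulo the conductor *)

Section Conductor.
Variables (A : comPzRingType) (R : subringClosed A).

Local Notation C := (conductor_quot R).
Local Notation pi := (\pi_C : A -> C).

Lemma mod_piM a b : pi (a * b) = pi a * pi b.
Proof. by rewrite -conductor_quot_pi_mul. Qed.

Lemma mod_piB a b : pi (a - b) = pi a - pi b.
Proof. by rewrite Quotient.pi_add Quotient.pi_opp. Qed.

Lemma mod_pi0 : pi 0 = 0.
Proof. by rewrite -[0 in LHS]subr0 mod_piB subrr. Qed.

Lemma order_mod_pi a : (pi a \in order_mod R) = (a \in R).
Proof.
apply/order_modP/idP => [[r Rr /conductor_quot_eqP/conductorP/(_ 1)]|Ra].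
  by rewrite mulr1 => ar; rewrite -(subrK r a) rpredD.
by exists a.
Qed.

Fact unit_mod_subproof (u : units A) : pi (uval u) * pi (uinv u) == 1.
Proof. by rewrite -mod_piM uvalV. Qed.
Definition unit_mod u : units C :=
  @Units C (pi (uval u), pi (uinv u)) (unit_mod_subproof u).

Lemma unit_modM : {morph unit_mod : u v / (u * v)%g}.
Proof. by move=> u v; apply: uval_inj; apply: mod_piM. Qed.

Lemma unit_modV : {morph unit_mod : u / (u^-1)%g}.
Proof. by move=> u; apply: uval_inj. Qed.

(** Membership in R can be tested modulo I, for u and for its inverse. This makes the map on unit
    quotients both well defined and injective. *)
Lemma unit_mod_subunits u :
  (unit_mod u \in subunits (order_mod R)) = (u \in subunits R).
Proof. by rewrite !inE; congr (_ && _); apply: order_mod_pi. Qed.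

Local Notation G := (unit_quot R).
Local Notation H := (unit_quot (order_mod R)).

Definition unit_quot_mod (x : G) : H := \pi_H (unit_mod (repr x)).

Lemma unit_quot_mod_pi u : unit_quot_mod (\pi_G u) = \pi_H (unit_mod u).
Proof.
apply/unit_quot_eqP; rewrite -unit_modV -unit_modM unit_mod_subunits.
by apply/unit_quot_eqP; rewrite reprK.
Qed.

Fact unit_quot_mod_multiplicative : {morph unit_quot_mod : x y / (x * y)%g}.
Proof.
elim/quotW=> u; elim/quotW=> v.
rewrite [X in unit_quot_mod X](unit_quot_pi_mul R u v).
rewrite !unit_quot_mod_pi unit_modM.
exact/esym/unit_quot_pi_mul.
Qed.

HB.instance Definition _ :=
  isMultiplicative.Build G H unit_quot_mod unit_quot_mod_multiplicative.

Lemma unit_quot_mod_inj : injective unit_quot_mod.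
Proof.
elim/quotW=> u; elim/quotW=> v; rewrite !unit_quot_mod_pi => /unit_quot_eqP.
rewrite -unit_modV -unit_modM unit_mod_subunits => uv.
exact/unit_quot_eqP.
Qed.

Hypothesis hR : finite_index R.

Lemma finite_conductor_quot : finite_set [set: C].
Proof.
have [s mem_s] := finite_set_seq hR.
pose F := seq_sub s; pose cls (a : A) : F := SeqSub (mem_s (\pi a)).
have clsP a b : cls a = cls b -> a - b \in R.
  by move=> /(congr1 val)/eqP; rewrite -Quotient.idealrBE.
(* [None] records the class of x itself, [Some c] that of its product with c. *)
pose f (x : C) : {ffun option F -> F} :=
  [ffun o => if o is Some c then cls (repr (val c) * repr x) else cls (repr x)].
apply: (@finite_set_injective _ _ f) finite_finset => x y fxy.
rewrite -[x]reprK -[y]reprK; apply/conductor_quot_eqP/conductorP => b.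
set d := _ - _; have Rd : d \in R.
  by apply: clsP; move/ffunP/(_ None): fxy; rewrite !ffunE.
pose c := \pi_(Quotient.quot R) b.
have Rcd : repr c * d \in R.
  rewrite mulrBr; apply: clsP.
  by move/ffunP/(_ (Some (SeqSub (mem_s c)))): fxy; rewrite !ffunE.
have Rbc : b - repr c \in R.
  by rewrite Quotient.idealrBE; apply/eqP; rewrite reprK.
(* With c also denoting its representative, b d = (b - c) d + c d, and both terms lie in R. *)
by rewrite mulrC -(subrK (repr c) b) mulrDl rpredD // rpredM.
Qed.

Lemma locally_associatedP :
  locally_associated R <-> forall x : units C,
    exists u : units A, (x / unit_mod u)%g \in subunits (order_mod R).
Proof.
have finH : finite_set [set: H].
  apply: (@finite_set_injective _ _ (fun x : H => uval (repr x))).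
    by move=> x y /uval_inj xy; rewrite -[x]reprK xy reprK.
  exact: finite_conductor_quot.
split=> [[f [g fK gK]] x|surj].
  (* An injective self-map of the finite group [H], hence onto. *)
  have h_inj : injective (unit_quot_mod \o g).
    exact: inj_comp unit_quot_mod_inj (can_inj gK).
  have [y /= yx] := finite_injective_surj finH h_inj (\pi x).
  exists (repr (g y)); apply/unit_quot_eqP.
  by rewrite -yx -{1}[g y]reprK unit_quot_mod_pi.
have inv y : {x | unit_quot_mod x = y}.
  apply: cid; elim/quotW: y => x; have [u xu] := surj x.
  by exists (\pi u); rewrite unit_quot_mod_pi; apply/esym/unit_quot_eqP.
exists unit_quot_mod; exists (fun y => sval (inv y)) => [x|y].
  by apply: unit_quot_mod_inj; apply: svalP (inv _).
exact: svalP (inv y).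
Qed.

(** * The two implications *)

Lemma associated_ideal_preserving : associated R -> ideal_preserving R.
Proof.
move=> assR J1 J2 [_ J1M] [_ J2M] J12 RJ12; apply: J12 => t J1t.
have [r [u [Rr tE]]] := assR t.
rewrite tE mulrC; apply: J2M; apply: RJ12; rewrite inE Rr /=.
have -> : r = uinv u * t by rewrite tE mulrCA (mulrC (uinv u)) uvalV mulr1.
exact: J1M.
Qed.

(** If a lift of x is r u, then x / u is the class of r, and its inverse is in R / I because R / I
    is a subring of a finite ring. *)
Lemma associated_locally_associated : associated R -> locally_associated R.
Proof.
move=> assR; apply/locally_associatedP => x.
have [r [u [Rr tE]]] := assR (repr (uval x)).
have xE : uval (x / unit_mod u)%g = pi r.
  transitivity (uval x * pi (uinv u)) => //.
  by rewrite -[uval x]reprK tE -mod_piM -mulrA uvalV mulr1.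
exists u; rewrite inE xE order_mod_pi Rr /=.
apply: (subring_inv finite_conductor_quot (x := pi r)).
  by rewrite order_mod_pi.
by rewrite -xE uvalV.
Qed.

Lemma ideal_preserving_unit_multiple (t : A) : GRing.lreg t ->
  ideal_preserving R ->
  exists v, t * v \in R /\ exists x, pi v * x = 1.
Proof.
move=> t_reg ipR.
pose V : {pred C} := [pred x | `[< exists2 v, t * v \in R & x = pi v >]].
have V_add : addr_closed V.
  split=> [|x y /asboolP[a Ra ->] /asboolP[b Rb ->]]; apply/asboolP.
    by exists 0; rewrite ?mod_pi0 ?mulr0 ?rpred0.
  by exists (a + b); rewrite ?conductor_quot_pi_add // mulrDr rpredD.
suff V_w e : e * e = e -> e != 1 ->
    exists2 w, w \in V & e * w = 0 /\ forall k, w ^+ k != 0.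
  have [_ /asboolP[v Rv ->] vx] :=
    unit_of_idempotents finite_conductor_quot V_add V_w.
  by exists v.
move=> ee e_neq1.
pose mult (J : {pred A}) : {pred A} :=
  [pred b | `[< exists2 a, a \in J & b = t * a >]].
have mult_ideal J : is_ideal J -> is_ideal (mult J).
  move=> [[J0 JB] JM]; split; first split.
  - by apply/asboolP; exists 0; rewrite ?mulr0.
  - move=> x y /asboolP[a Ja ->] /asboolP[b Jb ->]; apply/asboolP.
    by exists (a - b); [exact: JB | rewrite mulrBr].
  move=> x /asboolP[a Ja ->] b; apply/asboolP.
  by exists (b * a); [exact: JM | rewrite mulrCA].
pose J1 : {pred A} := [pred a | e * pi a == 0].
have J1_ideal : is_ideal J1.
  split; first split.
  - by rewrite inE /= mod_pi0 mulr0.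
  - by move=> x y /eqP xe /eqP ye; rewrite inE /= mod_piB mulrBr xe ye subrr.
  - by move=> x /eqP xe a; rewrite inE /= mod_piM mulrCA xe mulr0.
pose J2 : {pred A} := [pred a | `[< exists k, pi a ^+ k = 0 >]].
have J2_ideal : is_ideal J2.
  split; first split.
  - by apply/asboolP; exists 1%N; rewrite mod_pi0.
  - move=> x y /asboolP[k xk] /asboolP[l yl]; apply/asboolP.
    by exists (k + l)%N; rewrite mod_piB nilpotentB.
  - move=> x /asboolP[k xk] a; apply/asboolP; exists k.
    by rewrite mod_piM exprMn xk mulr0.
have ip := ipR _ _ (mult_ideal _ J1_ideal) (mult_ideal _ J2_ideal).
apply: contrapT => no_w; apply: ip.
  (* The nonzero idempotent 1 - e is killed by e but is not nilpotent; cancelling t shows that t (1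
     - e) is not in t J2. *)
  have /[swap]/[apply] : t * repr (1 - e) \in mult J1.
    apply/asboolP; exists (repr (1 - e)) => //.
    by rewrite inE /= reprK mulrBr mulr1 ee subrr.
  move=> /asboolP[a /asboolP[k ak] /t_reg aE].
  have {}ak : (1 - e) ^+ k = 0 by rewrite -[1 - e]reprK aE.
  have ff : (1 - e) * (1 - e) = 1 - e.
    by rewrite mulrBr mulr1 mulrBl mul1r ee subrr subr0.
  have fX : (1 - e) ^+ k.+1 = 1 - e.
    by elim: (k) => // l IHl; rewrite exprS IHl.
  by move: e_neq1; rewrite eq_sym -subr_eq0 -fX exprS ak mulr0 eqxx.
move=> w /andP[Rw /asboolP[a /eqP ea wE]]; apply/asboolP; exists a => //.
apply/asboolP; apply: contrapT => nil_a; apply: no_w; exists (pi a).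
  by apply/asboolP; exists a; rewrite -?wE.
by split=> // k; apply/eqP => ak; apply: nil_a; exists k.
Qed.

Lemma ideal_preserving_locally_associated :
  (forall t : A, t != 0 -> GRing.lreg t) ->
  ideal_preserving R -> locally_associated R -> associated R.
Proof.
move=> regA ipR /locally_associatedP laR t.
have [->|/regA t_reg] := eqVneq t 0.
  by exists 0, 1%g; rewrite rpred0 mul0r.
have [v [Rtv [x /eqP vx]]] := ideal_preserving_unit_multiple t_reg ipR.
pose w : units C := @Units C (pi v, x) vx.
have [u /andP[_]] := laR w.
rewrite invgF => /order_modP[r Rr uE].
exists (t * uval u), (u^-1)%g; split; last by rewrite -mulrA uvalV mulr1.
(* Modulo I, r is u / v, so t u agrees with (t v) r, which is in R. *)
have : pi (t * v * r) = pi (t * uval u).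
  rewrite mod_piM -uE.
  have -> : uval (unit_mod u / w)%g = pi (uval u) * x by [].
  by rewrite mod_piM mulrCA !mulrA -mulrA (eqP vx) mulr1 mulrC mod_piM.
by rewrite -order_mod_pi => <-; rewrite order_mod_pi rpredM.
Qed.

End Conductor.

Theorem corollary4p13 (K : fieldExtType rat)
    (R : subringClosed (ring_of_integers K)) (hR : finite_index R) :
  associated R <-> ideal_preserving R /\ locally_associated R.
Proof.
split=> [assR|[ipR laR]].
  split; first exact: associated_ideal_preserving.
  exact: associated_locally_associated.
apply: ideal_preserving_locally_associated => // t t_neq0 x y txy.
apply: val_inj; apply: (@mulfI K (val t)).
  by rewrite -(inj_eq val_inj) in t_neq0.
by rewrite -!GRing.valM txy.
Qed.
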